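(* Let $\mathcal{T}=(S,S_0,R)$ be a state-transition system. Define $R^a=\{((s,i),(s',i+1)) \mid i\in\mathbb{N},\ (s,s')\in R\setminus R_{id}\}\subseteq (S\times\mathbb{N})\times(S\times\mathbb{N})$, where $R_{id}=\{(s,s)\mid s\in S\}$, and $S_{lf}=\{s\in S \mid \exists i\ \forall j>i\ \neg\exists s'\ ((s,0),(s',j))\in (R^a)^*\}$, where $(R^a)^*$ is the reflexive transitive closure of $R^a$. If $S_0\subseteq S_{lf}$, then $\mathcal{T}$ is locally-finite.
   Context: A state-transition system is a triple $(S,S_0,R)$ with $S$ a (possibly infinite) set of states, $S_0\subseteq S$ the initial states and $R\subseteq S\times S$ the transition relation. A state is reachable if it is reachable from a state of $S_0$ by finitely many $R$-steps. An execution from a state $s$ is a sequence $s=s_0,s_1,s_2,\dots$ with $(s_i,s_{i+1})\in R$ for all $i$. The system is locally-finite if every execution starting from any reachable state goes through only finitely many distinct states. *)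

(* Defs.v *)
From Stdlib Require Import Relation_Operators.
From mathcomp Require Import all_boot.
From mathcomp Require Import boolp classical_sets functions cardinality.

Set Implicit Arguments.
Unset Strict Implicit.
Unset Printing Implicit Defensive.

Local Open Scope classical_set_scope.

Record transition_system := TransitionSystem {
  state : Type;
  init : set state;
  trans : set (state * state) }.

Definition star (T : Type) (R : set (T * T)) : set (T * T) :=
  [set p | clos_refl_trans T (fun x y => R (x, y)) p.1 p.2].

Definition reachable (M : transition_system) : set (state M) :=
  [set s | exists2 s0, init s0 & star (@trans M) (s0, s)].

(* Executions are infinite sequences; finite ones would visit finitely many
   states anyway, so including them would not affect local finiteness. *)
Definition execution_from (M : transition_system) (s : state M)
    (e : nat -> state M) : Prop :=
  e 0 = s /\ forall i, trans (e i, e i.+1).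

Definition locally_finite (M : transition_system) : Prop :=
  forall s : state M, reachable s ->
  forall e : nat -> state M, execution_from s e -> finite_set (range e).

Definition Rid (S : Type) : set (S * S) := [set (s, s) | s in [set: S]].

Definition Ra (S : Type) (R : set (S * S)) : set ((S * nat) * (S * nat)) :=
  [set p | exists i s s', (R `\` @Rid S) (s, s') /\ p = ((s, i), (s', i.+1))].

Definition Slf (M : transition_system) : set (state M) :=
  [set s | exists i : nat, forall j : nat, i < j ->
     ~ exists s' : state M, star (Ra (@trans M)) ((s, 0), (s', j))].

(* Main.v *)
(** Along an execution [e], count the non-stuttering steps. Prefixing a path from
    an initial state, the count is reached by the counter of [Ra], so it is
    bounded because initial states lie in [Slf]. The state [e n] depends only on
    the count at time [n], hence the range of [e] is finite. *)

From Stdlib Require Import Relation_Operators.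
Require Import Defs.
From mathcomp Require Import all_boot.
From mathcomp Require Import boolp classical_sets functions cardinality.

Local Open Scope classical_set_scope.

Lemma star_trans {T : Type} {Q : set (T * T)} {x y z : T} :
  star Q (x, y) -> star Q (y, z) -> star Q (x, z).
Proof. exact: rt_trans. Qed.

Section StutterCounting.
Context {S : Type} {R : set (S * S)}.

(** [Ra] drops the diagonal, so a stuttering step is matched by the empty path and leaves the
    counter unchanged. *)
Lemma star_Ra_step (x y : S) (i : nat) :
  R (x, y) -> star (Ra R) ((x, i), (y, i + `[< x <> y >])).
Proof.
move=> Rxy; case: asboolP => [xy|/contrapT <-]; last first.
  by rewrite addn0; exact: rt_refl.
apply: rt_step; exists i, x, y; rewrite addn1; split => //.
by split=> // -[z _ [zx zy]]; apply: xy; rewrite -zx.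
Qed.

Lemma star_Ra_of_star {x y : S} (i : nat) :
  star R (x, y) -> exists k, star (Ra R) ((x, i), (y, k)).
Proof.
(* The counter [i] stays general: in the transitive case the second path starts at the value where
   the first one ends. *)
rewrite /star /= => Rxy; elim: Rxy i => {x y} [x y Rxy|x|x y z _ IHxy _ IHyz] i.
- by exists (i + `[< x <> y >]); exact: star_Ra_step.
- by exists i; exact: rt_refl.
- have [k xy] := IHxy i; have [l yz] := IHyz k.
  by exists l; exact: (star_trans xy yz).
Qed.

Definition nstep (e : nat -> S) (n : nat) : nat :=
  \sum_(i < n) `[< e i <> e i.+1 >].

Lemma nstepS (e : nat -> S) (n : nat) :
  nstep e n.+1 = nstep e n + `[< e n <> e n.+1 >].
Proof. exact: big_ord_recr. Qed.

Lemma leq_nstep (e : nat -> S) {m n : nat} : m <= n -> nstep e m <= nstep e n.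
Proof.
move=> /subnK <-; elim: (n - m) => // d IHd.
by rewrite addSn nstepS (leq_trans IHd) ?leq_addr.
Qed.

Lemma star_Ra_nstep (e : nat -> S) (k n : nat) :
  (forall i, R (e i, e i.+1)) ->
  star (Ra R) ((e 0, k), (e n, k + nstep e n)).
Proof.
move=> Re; elim: n => [|n IHn].
  by rewrite /nstep big_ord0 addn0; exact: rt_refl.
by rewrite nstepS addnA; apply: (star_trans IHn); exact: star_Ra_step.
Qed.

(** The count never decreases, so if it agrees at two times, every step between them stutters. *)
Lemma nstep_determines (e : nat -> S) (m n : nat) :
  nstep e m = nstep e n -> e m = e n.
Proof.
wlog le_mn : m n / m <= n => [wl|].
  by case/orP: (leq_total m n) => le_mn; [|move=> /esym]; move=> /(wl _ _ le_mn).
rewrite -(subnK le_mn); elim: (n - m) => // d IHd.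
rewrite addSn nstepS => eq_m; move: (leq_nstep e (leq_addl d m)).
case: asboolP eq_m => [_ ->|/contrapT <- eq_m _]; first by rewrite addn1 ltnn.
by apply: IHd; rewrite eq_m addn0.
Qed.

Lemma finite_range_nstep (e : nat -> S) (b : nat) :
  (forall n, nstep e n <= b) -> finite_set (range e).
Proof.
(* Any time with count [k] will do, not only the earliest; the default 0 is taken only for counts
   never attained, and merely adds [e 0] to the finite image. *)
move=> le_b; pose first_time k := xget 0 [set n | nstep e n = k].
apply: (@sub_finite_set _ _ ((e \o first_time) @` `I_b.+1)); last first.
  exact/finite_image/finite_II.
move=> _ [n _ <-]; exists (nstep e n); first by rewrite /= ltnS.
apply: (nstep_determines e (first_time _) n).
by apply: (@xgetPex _ 0 [set m | nstep e m = nstep e n]); exists n.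
Qed.

End StutterCounting.

Theorem theorem14 (M : transition_system) :
  @init M `<=` @Slf M -> locally_finite M.
Proof.
move=> init_lf s [s0 /init_lf[b no_path] s0s] e [e0 Re].
have [k s0k] := star_Ra_of_star 0 s0s.
apply: (finite_range_nstep e b) => n; rewrite leqNgt; apply/negP => lt_bn.
(* The prefix from [s0] to [s] already brings the counter to [k], and continuing along [e] up to
   time [n] pushes it to [k + nstep e n], beyond the bound [b]. *)
apply: (no_path (k + nstep e n)); first exact: ltn_addl.
by exists (e n); apply: (star_trans s0k); rewrite -e0; exact: star_Ra_nstep.
Qed.
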